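(* For all integers $r,s$, put $$H=r^2+13rs+26s^2,\qquad A=r^2-13rs+26s^2,\qquad B=6r^2+182s^2 .$$ Then $H,A,B$ satisfy $$274A^2-169AB+26B^2+544AH-169BH+274H^2=0 .$$ The corresponding values $C=\frac{13(A+H)}2-B$, $D=\frac{167(A+H)}2$, $E=163(A+H)$, $T=170(A+H)$ are $$C=7r^2+156s^2,\quad D=167r^2+4342s^2,\quad E=326r^2+8476s^2,\quad T=340r^2+8840s^2 .$$ Consequently $$\begin{aligned}&(r^2+13rs+26s^2)^3+(r^2-13rs+26s^2)^3+(6r^2+182s^2)^3+(7r^2+156s^2)^3\\&\quad+(167r^2+4342s^2)^3+(326r^2+8476s^2)^3=(340r^2+8840s^2)^3 .\end{aligned}$$ *)

(* Defs.v *)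
From mathcomp Require Import all_boot all_order all_algebra.

Set Implicit Arguments.
Unset Strict Implicit.
Unset Printing Implicit Defensive.

Import GRing.Theory.
Local Open Scope ring_scope.

Definition Hform (r s : int) : int := r ^+ 2 + 13 * r * s + 26 * s ^+ 2.
Definition Aform (r s : int) : int := r ^+ 2 - 13 * r * s + 26 * s ^+ 2.
Definition Bform (r s : int) : int := 6 * r ^+ 2 + 182 * s ^+ 2.

(* The formulas for C and D involve an exact division by 2, so the four
   derived values are taken in rat; that they are integers is part of what the
   closed forms in r and s assert. *)
Definition Cval (A B H : int) : rat := 13 * (A + H)%:Q / 2 - B%:Q.
Definition Dval (A H : int) : rat := 167 * (A + H)%:Q / 2.
Definition Eval (A H : int) : rat := 163 * (A + H)%:Q.
Definition Tval (A H : int) : rat := 170 * (A + H)%:Q.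

(* Main.v *)
Require Import Defs.
From mathcomp Require Import all_boot all_order all_algebra.
From mathcomp Require Import ring.

Import GRing.Theory.
Local Open Scope ring_scope.

(** Put [S = A + H].  Every term of [H^3 + A^3 + B^3 + C^3 + D^3 + E^3 - T^3]
    can be grouped into a multiple of [S]: [A^3 + H^3] is divisible by
    [A + H = S], [B^3 + C^3] by [B + C = 13 S / 2], and [D], [E], [T] are
    themselves multiples of [S].  The remaining factor is quadratic in
    [A, B, H], and it is [3/4] of the quadratic form of the theorem
    ([sum_cubes_factor]).  So each zero of the quadratic form gives a solution
    of the equation in seven cubes ([sum_cubes_of_conic]).  The binary forms
    [H], [A], [B] in [r], [s] parametrize such zeros ([forms_on_conic]), and
    substituting them into the linear expressions for [C], [D], [E], [T] gives
    the closed forms.  The factorization is made in the rationals, because [C]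
    and [D] involve a division by 2, and the cubic identity is then pulled back
    to the integers. *)

(** With [P = A + H = 2 (r^2 + 26 s^2)] and [M = A - H = - 26 r s], the form is
    [273 P^2 + M^2 - 169 P B + 26 B^2].  Since [B = 3 P + 26 s^2], the part
    without [M^2] is [26 * 26 s^2 * (26 s^2 - P / 2) = - (26 r s)^2]. *)
Lemma forms_on_conic (r s : int) :
  274 * Aform r s ^+ 2 - 169 * Aform r s * Bform r s + 26 * Bform r s ^+ 2
    + 544 * Aform r s * Hform r s - 169 * Bform r s * Hform r s
    + 274 * Hform r s ^+ 2 = 0.
Proof. by rewrite /Aform /Bform /Hform; ring. Qed.

(** The coefficients 167/2, 163, 170 of [D], [E], [T] enter only through
    [(167/2)^3 + 163^3 - 170^3 = - 561/8], which is small enough to combine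
    with the other quadratic terms into a form with small coefficients. *)
Lemma sum_cubes_factor (A B H : int) :
  H%:Q ^+ 3 + A%:Q ^+ 3 + B%:Q ^+ 3
    + Cval A B H ^+ 3 + Dval A H ^+ 3 + Eval A H ^+ 3 - Tval A H ^+ 3
  = 3 / 4 * (A + H)%:Q
    * (274 * A ^+ 2 - 169 * A * B + 26 * B ^+ 2 + 544 * A * H
         - 169 * B * H + 274 * H ^+ 2)%:Q.
Proof. by rewrite /Cval /Dval /Eval /Tval; field. Qed.

(** Nothing forces [C] and [D] to be integral for arbitrary integers
    [A], [B], [H]; integral values [c], [d], [e], [t] of the four linear
    expressions are therefore taken as data. *)
Lemma sum_cubes_of_conic (A B H c d e t : int) :
  274 * A ^+ 2 - 169 * A * B + 26 * B ^+ 2 + 544 * A * H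
    - 169 * B * H + 274 * H ^+ 2 = 0 ->
  Cval A B H = c%:Q -> Dval A H = d%:Q -> Eval A H = e%:Q -> Tval A H = t%:Q ->
  H ^+ 3 + A ^+ 3 + B ^+ 3 + c ^+ 3 + d ^+ 3 + e ^+ 3 = t ^+ 3.
Proof.
move=> conic0 defC defD defE defT; have := sum_cubes_factor A B H.
rewrite conic0 mulr0 defC defD defE defT => /eqP.
by rewrite -!rmorphXn -!rmorphD -rmorphB intr_eq0 subr_eq0 => /eqP.
Qed.

Lemma derived_values (r s : int) :
  [/\ Cval (Aform r s) (Bform r s) (Hform r s)
        = (7 * r ^+ 2 + 156 * s ^+ 2)%:Q,
      Dval (Aform r s) (Hform r s) = (167 * r ^+ 2 + 4342 * s ^+ 2)%:Q,
      Eval (Aform r s) (Hform r s) = (326 * r ^+ 2 + 8476 * s ^+ 2)%:Q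
    & Tval (Aform r s) (Hform r s) = (340 * r ^+ 2 + 8840 * s ^+ 2)%:Q].
Proof.
by rewrite /Cval /Dval /Eval /Tval /Aform /Bform /Hform; split; field.
Qed.

Theorem proposition2p3 (r s : int) :
  let H := Hform r s in
  let A := Aform r s in
  let B := Bform r s in
  [/\ 274 * A ^+ 2 - 169 * A * B + 26 * B ^+ 2 + 544 * A * H
        - 169 * B * H + 274 * H ^+ 2 = 0,
      [/\ Cval A B H = (7 * r ^+ 2 + 156 * s ^+ 2)%:Q,
          Dval A H = (167 * r ^+ 2 + 4342 * s ^+ 2)%:Q,
          Eval A H = (326 * r ^+ 2 + 8476 * s ^+ 2)%:Q
        & Tval A H = (340 * r ^+ 2 + 8840 * s ^+ 2)%:Q]
    & (r ^+ 2 + 13 * r * s + 26 * s ^+ 2) ^+ 3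
        + (r ^+ 2 - 13 * r * s + 26 * s ^+ 2) ^+ 3
        + (6 * r ^+ 2 + 182 * s ^+ 2) ^+ 3
        + (7 * r ^+ 2 + 156 * s ^+ 2) ^+ 3
        + (167 * r ^+ 2 + 4342 * s ^+ 2) ^+ 3
        + (326 * r ^+ 2 + 8476 * s ^+ 2) ^+ 3
      = (340 * r ^+ 2 + 8840 * s ^+ 2) ^+ 3].
Proof.
move=> H A B; split; [exact: forms_on_conic | exact: derived_values |].
have [defC defD defE defT] := derived_values r s.
exact: sum_cubes_of_conic (forms_on_conic r s) defC defD defE defT.
Qed.
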